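(* Let $d\ge1$, let $X$ be a separable $F$-space and let $(T_a)_{a\in\mathbb R^d}$ be a strongly continuous operator group on $X$ satisfying the uniform frequent hypercyclicity criterion. Then $\bigcap_{a\in\mathbb R^d\setminus\{0\}}FHC(T_a)$ is nonempty.
   Context: A separable $F$-space is a separable topological vector space carrying a complete translation-invariant metric; $\|\cdot\|$ also denotes an $F$-norm on $X$ defining its topology, and the Euclidean norm on $\mathbb R^d$. An operator group $(T_a)_{a\in\mathbb R^d}$ on $X$ is a family of continuous linear operators on $X$ with $T_0=I$ and $T_{a+b}=T_aT_b$; it is strongly continuous if $a\mapsto T_af$ is continuous for each $f\in X$. Uniform frequent hypercyclicity criterion: there exists a dense set $D\subset X$ such that, for any $f\in D$, (1) $\sum_iT_{a_i}f$ converges for any sequence $(a_i)\subset\mathbb R^d$ with $\|a_i-a_j\|\ge1$ for any $i\ne j$; (2) $\sup\left\|\sum_iT_{a_i}f\right\|$ tends to zero as $C$ goes to infinity, where the supremum is taken over the sequences $(a_i)\subset\mathbb R^d$ such that $\|a_i-a_j\|\ge1$ for any $i\ne j$ and $\|a_i\|\ge C$ for any $i$. The lower density of $A\subset\mathbb N$ is $\liminf_{N\to+\infty}\frac{\#\{n\le N:\ n\in A\}}{N}$. $FHC(T)$ is the set of $x\in X$ such that for every nonempty open $U\subset X$ the set $\{n:\ T^nx\in U\}$ has positive lower density. *)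

(* Defs.v *)
From mathcomp Require Import all_boot all_order all_algebra.
From mathcomp Require Import complex.
From mathcomp Require Import all_classical all_reals all_analysis.

Set Implicit Arguments.
Unset Strict Implicit.
Unset Printing Implicit Defensive.

Import Order.TTheory GRing.Theory Num.Theory.
Import numFieldNormedType.Exports.

Local Open Scope classical_set_scope.
Local Open Scope ring_scope.

(* The scalar field of an F-space is either the real or the complex numbers;
   distances and F-norms take their values in R in both cases. *)
Variant scalar_kind := real_scalars | complex_scalars.

Definition scalars (R : realType) (k : scalar_kind) : numFieldType :=
  match k with
  | real_scalars => R
  | complex_scalars => complex R
  end.

Definition induces_topology (R : realType) (X : topologicalType)
    (dist : X -> X -> R) : Prop :=
  forall (x : X) (A : set X),
    nbhs x A <-> exists2 e : R, 0 < e & [set y | dist x y < e] `<=` A.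

Definition cauchy_sequence (R : realType) (X : Type) (dist : X -> X -> R)
    (u : nat -> X) : Prop :=
  forall e : R, 0 < e -> exists n0, forall m n,
    (n0 <= m)%N -> (n0 <= n)%N -> dist (u m) (u n) < e.

Record complete_invariant_metric (R : realType) (K : numFieldType)
    (X : topologicalLmodType K) (dist : X -> X -> R) : Prop := {
  dist_ge0 : forall x y, 0 <= dist x y ;
  dist_eq0 : forall x y, dist x y = 0 <-> x = y ;
  dist_sym : forall x y, dist x y = dist y x ;
  dist_triangle : forall x y z, dist x z <= dist x y + dist y z ;
  dist_translation : forall x y z, dist (x + z) (y + z) = dist x y ;
  dist_topology : induces_topology dist ;
  dist_complete : forall u : nat -> X,
    cauchy_sequence dist u -> exists l : X, u @ \oo --> l }.

(* Local convexity is not required, which rules out the library's [tvsType];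
   [topologicalLmodType] has jointly continuous addition and scaling. *)
Definition F_space (R : realType) (K : numFieldType)
    (X : topologicalLmodType K) : Prop :=
  exists dist : X -> X -> R, complete_invariant_metric dist.

Definition separable (T : topologicalType) : Prop :=
  exists2 S : set T, countable S & dense S.

Record is_Fnorm (R : realType) (K : numFieldType) (X : topologicalLmodType K)
    (N : X -> R) : Prop := {
  Fnorm_ge0 : forall x, 0 <= N x ;
  Fnorm_eq0 : forall x, N x = 0 -> x = 0 ;
  Fnorm_triangle : forall x y, N (x + y) <= N x + N y ;
  Fnorm_balanced : forall (l : K) x, `|l| <= 1 -> N (l *: x) <= N x ;
  Fnorm_scale_cvg0 : forall x, N (l *: x) @[l --> (0 : K^o)] --> 0 }.

(* The Euclidean norm; the library's norm [`|a|] on ['rV[R]_d] is the sup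
   norm. *)
Definition enorm (R : realType) (d : nat) (a : 'rV[R]_d) : R :=
  Num.sqrt (\sum_(i < d) a ord0 i ^+ 2).

Record operator_group (R : realType) (K : numFieldType)
    (X : topologicalLmodType K) (d : nat)
    (T : 'rV[R]_d -> {linear X -> X}) : Prop := {
  opgroup_continuous : forall a, continuous (T a) ;
  opgroup0 : forall f, T 0 f = f ;
  opgroupD : forall a b f, T (a + b) f = T a (T b f) }.

Definition strongly_continuous (R : realType) (K : numFieldType)
    (X : topologicalLmodType K) (d : nat)
    (T : 'rV[R]_d -> {linear X -> X}) : Prop :=
  forall f : X, continuous (fun a => T a f).

Definition one_separated (R : realType) (d : nat) (a : nat -> 'rV[R]_d) : Prop :=
  forall i j, i <> j -> 1 <= enorm (a i - a j).

(* [X] carries no chosen point in the library, so its operator [lim] does not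
   apply: the sum of a series is given by the (unique) limit [s] of its partial
   sums. *)
Definition uniform_FHC_criterion (R : realType) (K : numFieldType)
    (X : topologicalLmodType K) (N : X -> R) (d : nat)
    (T : 'rV[R]_d -> {linear X -> X}) : Prop :=
  exists2 D : set X, dense D & forall f, D f ->
    (forall a, one_separated a ->
       exists s : X, series (fun i => T (a i) f) @ \oo --> s) /\
    ereal_sup [set (N s)%:E | s in [set s : X | exists a, [/\ one_separated a,
         forall i, C <= enorm (a i) & series (fun i => T (a i) f) @ \oo --> s]]]
      @[C --> +oo] --> 0%E.

Definition lower_density (R : realType) (A : set nat) : \bar R :=
  limn_einf (fun M : nat =>
    (#|[set n : 'I_M.+1 | `[< A n >]]|%:R / M%:R : R)%:E).

Definition FHC (R : realType) (X : topologicalType) (S : X -> X) : set X :=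
  [set x | forall U : set X, open U -> U !=set0 ->
    (0 < lower_density R [set n | U (iter n S x)])%E].

(* Main.v *)
(* Attach to each index k a set B_k of points b of the lattice 4^r_k Z^d lying in
   shells 2 * 4^s <= |b| <= 3 * 4^s, where s runs over the numbers
   2^k (2m + 1), m >= r_k.  Different indices use different shells, so points of
   B_k and B_k' are at distance at least 4^max(r_k, r_k'); each shell of index k
   is followed by another one of bounded ratio; and the orbit (n a)_n
   comes back near the lattice with bounded gaps, because its image in the torus
   is recurrent.  Hence for every a <> 0 the set of n with n a close to B_k has
   positive lower density.  The vector sum_k sum_(b in B_k) T_(-b) f_k, with (f_k)
   in the dense set of the criterion and r_k large, is then moved close to f_k
   by T_(n a) as soon as n a is close to B_k.  Distances in R^d are measured with
   the sup norm, which is bounded by the Euclidean one. *)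
Require Import Defs.
From mathcomp Require Import all_boot all_order all_algebra.
From mathcomp Require Import all_classical all_reals all_analysis.
From mathcomp Require Import zify ring lra.
Import Order.TTheory GRing.Theory Num.Theory.
Import numFieldNormedType.Exports.
Set Implicit Arguments.
Unset Strict Implicit.
Local Open Scope classical_set_scope.
Local Open Scope ring_scope.

(** * Recurrence of orbits modulo a lattice *)

Lemma normr_le_enorm (R : realType) (d : nat) (a : 'rV[R]_d) : `|a| <= enorm a.
Proof.
rewrite [leLHS]mx_normrE; apply: bigmax_le => [|[i j] _ /=].
  exact: sqrtr_ge0.
rewrite -sqrtr_sqr ler_wsqrtr// (bigD1 j)//= ord1 lerDl.
by apply: sumr_ge0 => k _; exact: sqr_ge0.
Qed.

(** One time is chosen for each value that [key] takes; [L] is an upper bound of these finitely many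
    times. *)
Lemma finite_recurrence (F : finType) (key : nat -> F) :
  exists L, forall m, exists2 n, (n <= L)%N & key n = key m.
Proof.
pose w c := xget 0%N [set n | key n = c].
exists (\max_(c : F) w c) => m; exists (w (key m)); first exact: leq_bigmax.
exact: (@xgetPex _ 0%N [set n | key n = key m] (ex_intro _ m erefl)).
Qed.

(* Pigeonhole on the torus: a window of times is translated back by a time at
   which the orbit already visited the same cell. *)
Lemma lattice_recurrence (R : realType) (d : nat) (a : 'rV[R]_d) (r e : R) :
  0 < r -> 0 < e ->
  exists L, forall m, exists p, exists z : 'rV[int]_d,
    (m <= p <= m + L)%N /\ `|a *+ p - r *: map_mx intr z| < e.
Proof.
move=> r0 e0.
(* Cutting each side of the torus into [Q] cells makes a cell narrower than [e]. *)
pose Q := (Num.truncn (r / e)).+1.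
have Q0 : 0 < Q%:R :> R by rewrite ltr0n.
have rQ : r / Q%:R < e.
  rewrite ltr_pdivrMr// mulrC -ltr_pdivrMr//.
  by have /andP[] := truncn_itv (divr_ge0 (ltW r0) (ltW e0)).
pose y n i : R := Q%:R * (a ord0 i *+ n) / r.
have QZ : (0 < Q%:Z)%R by [].
pose key n : {ffun 'I_d -> 'I_Q} :=
  [ffun i => inord `|(Num.floor (y n i) %% Q%:Z)%Z|%N].
have [L HL] := finite_recurrence key.
exists L => m.
(* Comparing with time [m + L] rather than [m] keeps the difference [m + L - n] in the window, since
   [n <= L]. *)
have [n nL keyE] := HL (m + L)%N.
have mod_eq i : (Num.floor (y (m + L)%N i) = Num.floor (y n i) %[mod Q%:Z])%Z.
  have bd t : (`|(t %% Q%:Z)%Z| < Q)%N.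
    by rewrite -ltz_nat gez0_abs ?modz_ge0// ltz_pmod.
  move/ffunP: keyE => /(_ i); rewrite !ffunE => /(congr1 val) /=.
  rewrite !inordK ?bd// => /(congr1 Posz).
  by rewrite !gez0_abs ?modz_ge0.
pose z : 'rV[int]_d :=
  \row_i ((Num.floor (y (m + L)%N i) - Num.floor (y n i)) %/ Q%:Z)%Z.
exists (m + L - n)%N, z; split; first by lia.
apply: le_lt_trans rQ; rewrite [leLHS]mx_normrE.
apply: bigmax_le => [|[i0 i] _ /=]; first by rewrite divr_ge0// ltW.
rewrite !mxE ord1 mulmxnE.
have dv : (Q%:Z %| Num.floor (y (m + L)%N i) - Num.floor (y n i))%Z.
  by rewrite -eqz_mod_dvd; apply/eqP.
have zE : ((Num.floor (y (m + L)%N i))%:~R - (Num.floor (y n i))%:~R : R)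
    = ((Num.floor (y (m + L)%N i) - Num.floor (y n i)) %/ Q%:Z)%Z%:~R * Q%:R.
  by rewrite -intrB -[in LHS](divzK dv) intrM.
set w := (_ %/ _)%Z in zE *.
have yE : a ord0 i *+ (m + L - n) - r * w%:~R =
    (y (m + L)%N i - y n i - w%:~R * Q%:R) * (r / Q%:R).
  rewrite mulrnBr; last by lia.
  rewrite /y; field.
  by rewrite !gt_eqF.
rewrite yE normrM (ger0_norm (divr_ge0 (ltW r0) (ltW Q0))).
apply: ler_piMl; first by rewrite divr_ge0// ltW.
(* What is left is a difference of two fractional parts. *)
have /andP[f1 f2] := floor_itv (y (m + L)%N i).
have /andP[f3 f4] := floor_itv (y n i).
rewrite ler_norml; rewrite !intrD in f2 f4.
by apply/andP; split; lra.
Qed.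

(** * Positive lower density from windows in geometric shells *)

(** The [c] windows are disjoint, so a point of [H] chosen in each gives an injection into the
    counted set. *)
Lemma card_ge_windows (H : set nat) (P L c M : nat) :
  (P + c * L.+1 <= M.+1)%N ->
  (forall i, (i < c)%N -> exists2 p, H p &
     (P + i * L.+1 <= p <= P + i * L.+1 + L)%N) ->
  (c <= #|[set n : 'I_M.+1 | `[< H n >]]|)%N.
Proof.
move=> cM win.
have /choice[f fP] : forall i : 'I_c, exists p, H p /\
    (P + i * L.+1 <= p <= P + i * L.+1 + L)%N.
  by move=> i; have [p Hp ip] := win i (ltn_ord i); exists p.
have fM i : (f i < M.+1)%N.
  have [_ /andP[_ fi]] := fP i; have ic := ltn_ord i.
  apply: leq_ltn_trans fi _; apply: leq_trans cM.
  by rewrite -addnS -addnA leq_add2l -mulSnr leq_mul2r ic orbT.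
have finj : injective (fun i : 'I_c => Ordinal (fM i)).
  move=> i j /(congr1 val) /= fij; apply: val_inj => /=.
  have [_ /andP[i1 i2]] := fP i; have [_ /andP[j1 j2]] := fP j.
  rewrite fij in i1 i2.
  case: (ltngtP i j) => // ij; [have := leq_mul ij (leqnn L.+1) |
    have := leq_mul ij (leqnn L.+1)]; lia.
rewrite -[leqLHS]card_ord -(card_imset _ finj).
apply: subset_leq_card; apply/fintype.subsetP => n /imsetP[i _ ->].
by rewrite inE; apply/asboolP; exact: (fP i).1.
Qed.

Lemma lower_density_gt0 (R : realType) (H : set nat) (c : R) (M0 : nat) :
  0 < c ->
  (forall M, (M0 <= M)%N ->
     c * M%:R <= #|[set n : 'I_M.+1 | `[< H n >]]|%:R) ->
  (0 < lower_density R H)%E.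
Proof.
move=> c0 cH; apply: (@lt_le_trans _ _ c%:E); first by rewrite lte_fin.
rewrite /lower_density limn_einf_lim.
set u := (fun M : nat => _).
have -> : limn (einfs u) = ereal_sup (range (einfs u)).
  by apply/cvg_lim => //; exact: cvg_einfs_sup.
(* A liminf is at least the infimum over any tail; this tail starts at [M0.+1] so that the divisor
   [M] is positive. *)
apply: (@le_trans _ _ (einfs u M0.+1)); last first.
  by apply: ereal_sup_ubound; exists M0.+1.
apply: le_ereal_inf_tmp => _ [M /= M0M <-].
have M0' : (0 : R) < M%:R by rewrite ltr0n (leq_trans _ M0M).
by rewrite /u lee_fin ler_pdivlMr// cH// ltnW.
Qed.

Lemma bracket_geometric (R : realType) (s y : R) (G : nat) :
  0 < s -> (0 < G)%N -> s <= y ->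
  exists m, s * 4 ^+ (m * G) <= y < s * 4 ^+ (m.+1 * G).
Proof.
move=> s0 G0 sy.
have [n yn] : exists n, y < s * 4 ^+ (n * G).
  exists (Num.truncn (y / s)).+1.
  rewrite mulrC -ltr_pdivrMr//.
  have /andP[_ /lt_le_trans->//] := truncn_itv (divr_ge0 (le_trans (ltW s0) sy) (ltW s0)).
  rewrite -natrX ler_nat; apply: leq_trans (ltnW (@ltn_expl 4 _ _)) _ => //.
  by rewrite leq_exp2l// leq_pmulr.
have ex : exists n, y < s * 4 ^+ (n * G) by exists n.
case: (ex_minnP ex) => -[|m] ym mmin.
  by move: ym; rewrite mul0n mulr1 ltNge sy.
exists m; rewrite ym andbT leNgt; apply/negP => /mmin.
by rewrite ltnn.
Qed.

(** For large [M], take the last scale x = 4^(s + m G) with 3 x <= M t. The times p with p t between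
    2 x + 1 and 3 x - 1 fill an interval of length about x / t, a fixed fraction of [M] because M t
    < 3 x 4^G, and [S] meets every block of [L.+1] consecutive times. *)
Lemma lower_density_shells (R : realType) (S H : set nat) (L G s : nat) (t : R) :
  0 < t -> (0 < G)%N ->
  (forall m, exists2 p, S p & (m <= p <= m + L)%N) ->
  (forall m p, S p ->
     2 * 4 ^+ (s + m * G) + 1 <= p%:R * t <= 3 * 4 ^+ (s + m * G) - 1 -> H p) ->
  (0 < lower_density R H)%E.
Proof.
move=> t0 G0 win SH.
pose K : R := 4 ^+ G; pose l : R := L.+1%:R.
have K1 : 1 <= K by rewrite exprn_ege1// ler1n.
have l1 : 1 <= l by rewrite /l ler1n.
have [K0 l0] : 0 < K /\ 0 < l by split; lra.
(* Chosen so that W <= M t < 3 x K forces x >= 4 + 2 t + 2 t l, the bound behind [gap]. *)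
pose W : R := 3 * (4 + 2 * t + 2 * t * l) * K.
have W0 : 0 < W.
  have tl0 : 0 < t * l by rewrite mulr_gt0.
  by rewrite mulr_gt0//; lra.
pose M1 := (Num.truncn (W / t)).+1; pose M2 := (Num.truncn (3 * 4 ^+ s / t)).+1.
have s0 : (0 : R) < 3 * 4 ^+ s by rewrite mulr_gt0// exprn_gt0.
(* From M t < 3 x K, M / (6 K l) is at most x / (2 t l), and at least that many windows fit in the
   shell. *)
apply: (@lower_density_gt0 _ _ (6 * K * l)^-1 (M1 + M2)%N).
  by rewrite invr_gt0 !mulr_gt0.
move=> M MM.
have large y k : 0 < y -> ((Num.truncn (y / t)).+1 <= k)%N -> y <= k%:R * t.
  move=> y0 yk; rewrite -ler_pdivrMr//.
  have /andP[_ /ltW/le_trans->//] := truncn_itv (divr_ge0 (ltW y0) (ltW t0)).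
  by rewrite ler_nat.
have WM : W <= M%:R * t by apply: large => //; apply: leq_trans MM; exact: leq_addr.
have sM : 3 * 4 ^+ s <= M%:R * t.
  by apply: large => //; apply: leq_trans MM; exact: leq_addl.
have [m /andP[mM Mm]] := @bracket_geometric _ _ _ G s0 G0 sM.
pose x : R := 4 ^+ (s + m * G).
have xE : 3 * 4 ^+ s * 4 ^+ (m * G) = 3 * x by rewrite /x exprD mulrA.
have xKE : 3 * 4 ^+ s * 4 ^+ (m.+1 * G) = 3 * x * K.
  by rewrite /x /K mulSn addnC !exprD !mulrA.
rewrite xE in mM; rewrite xKE in Mm.
have x0 : 0 < x by rewrite exprn_gt0.
have xbig : 4 + 2 * t + 2 * t * l <= x.
  have : W <= 3 * x * K by apply: le_trans WM (ltW Mm).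
  by rewrite /W ler_pM2r// ler_pM2l.
pose lo := (2 * x + 1) / t; pose hi := (3 * x - 1) / t.
have lo0 : 0 <= lo by rewrite divr_ge0//; lra.
pose P := (Num.truncn lo).+1.
have /andP[Plo loP] := truncn_itv lo0; rewrite -/P in loP.
have PE : P%:R = (Num.truncn lo)%:R + 1 :> R by rewrite /P -natr1.
(* The extra 1 pays for the truncation in [c]. *)
have gap : x / (2 * t * l) + 1 <= (hi - P%:R) / l.
  rewrite ler_pdivlMr//.
  apply: (@le_trans _ _ (hi - lo - 1)); last by rewrite PE; lra.
  have -> : hi - lo - 1 = (x - 2 - t) / t by rewrite /hi /lo; field; rewrite gt_eqF.
  rewrite ler_pdivlMr//.
  have -> : (x / (2 * t * l) + 1) * l * t = x / 2 + l * t.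
    by field; rewrite !gt_eqF.
  by nra.
have xq0 : 0 <= x / (2 * t * l) by rewrite divr_ge0// ?ltW// !mulr_gt0.
have hP0 : 0 <= (hi - P%:R) / l by apply: le_trans gap; rewrite addr_ge0.
pose c := Num.truncn ((hi - P%:R) / l).
have /andP[c1 c2] := truncn_itv hP0; rewrite -/c -natr1 in c1 c2.
have top : P%:R + c%:R * l <= hi.
  by move: c1; rewrite ler_pdivlMr//; lra.
apply: (@le_trans _ _ c%:R).
  apply: (@le_trans _ _ (x / (2 * t * l))); last first.
    by rewrite -(lerD2r 1); apply: le_trans gap (ltW c2).
  rewrite ler_pdivlMr ?mulr_gt0//.
  have -> : (6 * K * l)^-1 * M%:R * (2 * t * l) = M%:R * t / (3 * K).
    by field; rewrite !gt_eqF.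
  by rewrite ler_pdivrMr ?mulr_gt0//; lra.
rewrite ler_nat; apply: (@card_ge_windows _ P L).
  rewrite -(ler_nat R) natrD natrM.
  apply: (le_trans top); rewrite -natr1 /hi ler_pdivrMr//; nra.
move=> i ic.
have [p Sp pi] := win (P + i * L.+1)%N; exists p => //.
have /andP[p1 p2] := pi.
apply: (SH m) => //; rewrite -/x; apply/andP; split.
  rewrite -ler_pdivrMr//; apply: le_trans (ltW loP) _.
  by rewrite ler_nat; apply: leq_trans p1; exact: leq_addr.
rewrite -ler_pdivlMr//; apply: le_trans top.
rewrite /l -natrM -natrD ler_nat; apply: leq_trans p2 _.
rewrite -addnA leq_add2l; apply: leq_trans (leq_mul ic (leqnn _)).
by rewrite mulSn addnC leq_add2r.
Qed.

(** * Lattice shells attached to the indices *)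

(** Every positive integer has this form for exactly one pair, [k] being its 2-adic valuation; the
    exponents of a fixed [k] form an arithmetic progression. *)
Definition shell_exponent (k m : nat) : nat := (2 ^ k * m.*2.+1)%N.

Lemma leq_shell_exponent k m : (m <= shell_exponent k m)%N.
Proof.
rewrite /shell_exponent; apply: leq_trans (leq_pmull _ _); last by rewrite expn_gt0.
by rewrite -addnn; lia.
Qed.

Lemma logn_shell_exponent k m : logn 2 (shell_exponent k m) = k.
Proof.
rewrite lognM ?expn_gt0// pfactorK// [logn 2 m.*2.+1]lognE.
by rewrite dvdn2 /= odd_double /= addn0.
Qed.

Lemma shell_exponent_injl k k' m m' :
  shell_exponent k m = shell_exponent k' m' -> k = k'.
Proof. by move=> /(congr1 (logn 2)); rewrite !logn_shell_exponent. Qed.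

Lemma shell_exponent_injr k m m' :
  shell_exponent k m = shell_exponent k m' -> m = m'.
Proof.
by rewrite /shell_exponent => /eqP; rewrite eqn_pmul2l ?expn_gt0// => /eqP; lia.
Qed.

(* The shells of radius about [4 ^ shell_exponent k m] belong to the index [k]:
   those of a fixed index recur with a bounded ratio, and those of distinct
   indices are far apart. *)
Definition shell_lattice (R : realType) (d r k : nat) : set 'rV[R]_d :=
  [set b : 'rV[R]_d | exists m (z : 'rV[int]_d), [/\ (r <= m)%N,
     2 * 4 ^+ shell_exponent k m <= `|b| <= 3 * 4 ^+ shell_exponent k m &
     b = 4 ^+ r *: map_mx intr z]].
Arguments shell_lattice R d r k _ : clear implicits.

Lemma norm_entry_le (R : realType) (d : nat) (a : 'rV[R]_d) i : `|a ord0 i| <= `|a|.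
Proof.
by rewrite [leRHS]mx_normrE; exact: (le_bigmax _ (fun ij => `|a ij.1 ij.2|) (ord0, i)).
Qed.

Lemma shell_lattice_norm (R : realType) d r k (b : 'rV[R]_d) :
  shell_lattice R d r k b -> 4 ^+ r <= `|b|.
Proof.
move=> [m [z [rm /andP[bm _] _]]]; apply: le_trans bm.
apply: (@le_trans _ _ (4 ^+ shell_exponent k m)).
  by rewrite ler_eXn2l ?ltr1n// (leq_trans rm)// leq_shell_exponent.
by rewrite ler_peMl ?exprn_ge0// ler1n.
Qed.

Lemma shell_lattice_separated (R : realType) d r k (b b' : 'rV[R]_d) :
  shell_lattice R d r k b -> shell_lattice R d r k b' -> b <> b' ->
  4 ^+ r <= `|b - b'|.
Proof.
move=> [m [z [_ _ ->]]] [m' [z' [_ _ ->]]] bb'.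
have [i zi] : exists i, z ord0 i != z' ord0 i.
  apply/existsP; rewrite -negb_forall; apply/negP => /forallP zz'.
  by apply: bb'; congr (_ *: map_mx _ _); apply/rowP => i; apply/eqP/zz'.
apply: le_trans (norm_entry_le _ i).
rewrite !mxE -mulrBr normrM ger0_norm ?exprn_ge0// ler_peMr ?exprn_ge0//.
rewrite -intrB -intr_norm.
by rewrite ler1z -gtz0_ge1 normr_gt0 subr_eq0.
Qed.

(** Distinct indices never share an exponent. For exponents u < v, the smaller shell stays within 3
    * 4^u <= (3/4) 4^v and the larger one beyond 2 * 4^v; moreover v bounds both [r] and [r']. *)
Lemma shell_lattice_far (R : realType) d r k r' k' (b b' : 'rV[R]_d) :
  shell_lattice R d r k b -> shell_lattice R d r' k' b' -> k <> k' ->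
  4 ^+ r <= `|b - b'| /\ 4 ^+ r' <= `|b - b'|.
Proof.
move=> [m [_ [rm bm _]]] [m' [_ [rm' bm' _]]] kk'.
have e1 := leq_trans rm (leq_shell_exponent k m).
have e2 := leq_trans rm' (leq_shell_exponent k' m').
have exps (u v : nat) (x y : 'rV[R]_d) : (u < v)%N ->
    2 * 4 ^+ u <= `|x| <= 3 * 4 ^+ u -> 2 * 4 ^+ v <= `|y| <= 3 * 4 ^+ v ->
    4 ^+ v <= `|x - y|.
  move=> uv /andP[_ xu] /andP[yv _].
  have : 4 * 4 ^+ u <= 4 ^+ v :> R by rewrite -exprS ler_eXn2l// ltr1n.
  have := lerB_dist y x; rewrite distrC.
  by have : 0 <= 4 ^+ u :> R by []; lra.
have mono (u v : nat) : (u <= v)%N -> 4 ^+ u <= 4 ^+ v :> R.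
  by move=> uv; rewrite ler_eXn2l// ltr1n.
case: (ltngtP (shell_exponent k m) (shell_exponent k' m')) => uv.
- have D := exps _ _ _ _ uv bm bm'.
  by split; apply: le_trans D; apply: mono => //; apply: leq_trans (ltnW uv).
- have D := exps _ _ _ _ uv bm' bm; rewrite distrC in D.
  by split; apply: le_trans D; apply: mono => //; apply: leq_trans (ltnW uv).
- by case: kk'; exact: shell_exponent_injl uv.
Qed.

(** The criterion sums over sequences indexed by [nat], so the points must be listed without
    repetition. *)
Lemma shell_lattice_enum (R : realType) d r k : (1 <= d)%N ->
  exists b : nat -> 'rV[R]_d, injective b /\ range b = shell_lattice R d r k.
Proof.
move=> d1; set B := shell_lattice R d r k.
have ctB : countable B.
  pose h (z : 'rV[int]_d) : 'rV[R]_d := 4 ^+ r *: map_mx intr z.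
  apply: (@sub_countable _ _ _ (range h)).
    by apply: subset_card_le => _ [m [z [_ _ ->]]]; exists z.
  by apply: sub_countable (card_image_le _ _) (countableP _).
have infB : infinite_set B.
  (* A constant vector on the inner boundary of each shell; [d1] supplies a coordinate telling them
     apart. *)
  pose g m : 'rV[R]_d := const_mx (2 * 4 ^+ shell_exponent k (r + m)).
  have g_inj : injective g.
    move=> m m' /rowP/(_ (Ordinal d1)); rewrite !mxE => /mulfI.
    move/(_ (lt0r_neq0 _)) => gm; apply: (@addnI r).
    apply: (@shell_exponent_injr k).
    by apply: (ieexprIn (x := 4 : R)); rewrite ?pnatr_eq1 ?gm.
  have gB : range g `<=` B.
    move=> _ [m _ <-].
    have rE : (r <= shell_exponent k (r + m))%N.
      by apply: leq_trans (leq_shell_exponent _ _); exact: leq_addr.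
    have gnorm : `|g m| = 2 * 4 ^+ shell_exponent k (r + m).
      have g0 : 0 <= 2 * 4 ^+ shell_exponent k (r + m) :> R by rewrite mulr_ge0.
      apply/le_anti/andP; split.
        rewrite [leLHS]mx_normrE; apply: bigmax_le => // -[i j] _ /=.
        by rewrite mxE ger0_norm.
      have := norm_entry_le (g m) (Ordinal d1).
      by rewrite mxE ger0_norm.
    exists (r + m)%N, (const_mx (2 * 4 ^+ (shell_exponent k (r + m) - r))).
    split; [exact: leq_addr| |].
      by rewrite gnorm lexx /= ler_pM2r ?exprn_gt0// ler_nat.
    by apply/rowP => i; rewrite !mxE rmorphM rmorphXn /= mulrCA -exprD subnKC//.
  apply: (sub_infinite_set gB); rewrite (eq_finite_set (inj_card_eq (in2W g_inj))).
  exact: infinite_nat.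
have := eq_card_nat ctB infB; rewrite card_eq_sym => /card_set_bijP[b [bB b_inj bsurj]].
exists b; split; first exact: in2TT b_inj.
by apply/seteqP; split=> [_ [n _ <-]|]; [exact: bB|exact: bsurj].
Qed.

Lemma shell_lattice_hits (R : realType) d r k (a : 'rV[R]_d) (e : R) (H : set nat) :
  a <> 0 -> 0 < e <= 1 ->
  (forall n b, shell_lattice R d r k b -> `|a *+ n - b| < e -> H n) ->
  (0 < lower_density R H)%E.
Proof.
move=> a0 /andP[e0 e1] hits.
have [L HL] := @lattice_recurrence R d a (4 ^+ r) e (exprn_gt0 _ (ltr0Sn R 3)) e0.
have ta : 0 < `|a| by rewrite normr_gt0; apply/eqP.
(* From [shell_exponent k r] on, the exponents of index [k] advance by [2 ^ k * 2]. *)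
apply: (@lower_density_shells R
  [set p | exists z : 'rV[int]_d, `|a *+ p - 4 ^+ r *: map_mx intr z| < e]
  _ L (2 ^ k * 2)%N (shell_exponent k r) `|a| ta).
- by rewrite muln_gt0 expn_gt0.
- by move=> m; have [p [z [mp pz]]] := HL m; exists p => //; exists z.
- move=> m p [z pz] /andP[lo hi]; set b := 4 ^+ r *: _ in pz.
  (* The margins of 1 in the shell absorb the distance, below [e <= 1], from [a *+ p] to [b]. *)
  apply: (hits p b _ pz); exists (r + m)%N, z; split=> //; first exact: leq_addr.
  have eE : shell_exponent k (r + m) = (shell_exponent k r + m * (2 ^ k * 2))%N.
    by rewrite /shell_exponent -!muln2; lia.
  rewrite -eE in lo hi.
  have pa : `|a *+ p| = p%:R * `|a| by rewrite normrMn mulr_natl.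
  have := lerB_dist (a *+ p) b; have := lerB_dist b (a *+ p).
  by rewrite [`|b - _|]distrC pa => h1 h2; apply/andP; split; lra.
Qed.

(** * F-norms and convergence of series *)

(** Otherwise the ball of radius [N 0] about 0 would be a neighbourhood of 0 that misses 0. *)
Lemma Fnorm0 (R : realType) (K : numFieldType) (X : topologicalLmodType K)
    (N : X -> R) :
  is_Fnorm N -> induces_topology (fun x y => N (y - x)) -> N 0 = 0.
Proof.
move=> NF Ntop; apply/eqP; rewrite eq_le (Fnorm_ge0 NF) andbT.
rewrite leNgt; apply/negP => N0.
have : nbhs (0 : X) [set y | N (y - 0) < N 0] by apply/Ntop; exists (N 0).
by move=> /nbhs_singleton /=; rewrite subr0 ltxx.
Qed.

Lemma FnormN (R : realType) (K : numFieldType) (X : topologicalLmodType K)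
    (N : X -> R) x : is_Fnorm N -> N (- x) = N x.
Proof.
move=> NF; have le y : N (- y) <= N y.
  by rewrite -scaleN1r; apply: (Fnorm_balanced NF); rewrite normrN1.
by apply/le_anti/andP; split; [exact: le|rewrite -[x in leLHS]opprK; exact: le].
Qed.

Lemma Fnorm_sum (R : realType) (K : numFieldType) (X : topologicalLmodType K)
    (N : X -> R) (I : Type) (s : seq I) (F : I -> X) :
  is_Fnorm N -> induces_topology (fun x y => N (y - x)) ->
  N (\sum_(i <- s) F i) <= \sum_(i <- s) N (F i).
Proof.
move=> NF Ntop; elim/big_ind2 : _ => //; first by rewrite (Fnorm0 NF Ntop).
by move=> x y u v xy uv; apply: le_trans (Fnorm_triangle NF _ _) (lerD xy uv).
Qed.

Lemma Fnorm_cvgP (R : realType) (K : numFieldType) (X : topologicalLmodType K)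
    (N : X -> R) (u : nat -> X) (l : X) :
  induces_topology (fun x y => N (y - x)) ->
  u @ \oo --> l <->
  forall e, 0 < e -> exists n0, forall n, (n0 <= n)%N -> N (u n - l) < e.
Proof.
move=> Ntop; split=> [ul e e0|ul A /Ntop[e e0 eA]].
  have /ul : nbhs l [set y | N (y - l) < e] by apply/Ntop; exists e.
  by move=> [n0 _ n0P]; exists n0.
by have [n0 n0P] := ul e e0; exists n0 => // n /= /n0P; exact: eA.
Qed.

Lemma sum_half_lt (R : realType) m n :
  \sum_(m <= i < n) (2^-1 : R) ^+ i <= 2 * 2^-1 ^+ m.
Proof.
have [nm|mn] := leqP n m; first by rewrite big_geq// mulr_ge0.
suff -> : \sum_(m <= i < n) (2^-1 : R) ^+ i = 2 * 2^-1 ^+ m - 2 * 2^-1 ^+ n.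
  by rewrite gerBl mulr_ge0.
have := telescope_sumr (fun i => - (2 * (2^-1 : R) ^+ i)) (ltnW mn).
rewrite opprK [RHS]addrC => <-; apply: eq_bigr => i _.
by rewrite exprS mulrA divff// mul1r; lra.
Qed.

(** Completeness is given for [dist], the estimates for [N]. Translation invariance moves distances
    to 0, where the common topology compares the two. *)
Lemma Fnorm_summable (R : realType) (K : numFieldType)
    (X : topologicalLmodType K) (N : X -> R) (u : nat -> X) :
  F_space R X -> is_Fnorm N -> induces_topology (fun x y => N (y - x)) ->
  (forall k, N (u k) <= 2^-1 ^+ k) -> exists l : X, series u @ \oo --> l.
Proof.
move=> [dist dP] NF Ntop uN; apply: (dist_complete dP) => e e0.
have : nbhs (0 : X) [set y | dist 0 y < e] by apply/(dist_topology dP); exists e.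
move=> /Ntop[e' e'0 e'P].
have [n0 n0P] : exists n0, 2 * (2^-1 : R) ^+ n0 < e'.
  set n := (Num.truncn (2 / e')).+1; exists n.
  have : 2 / e' < 2 ^+ n.
    have /andP[_ /lt_trans->//] := truncn_itv (divr_ge0 (ler0n R 2) (ltW e'0)).
    by rewrite -natrX ltr_nat ltn_expl.
  by rewrite ltr_pdivrMr// exprVn ltr_pdivrMr ?exprn_gt0// mulrC.
have key m n : (n0 <= m <= n)%N -> dist (series u m) (series u n) < e.
  move=> /andP[n0m mn].
  have -> : dist (series u m) (series u n) = dist 0 (series u n - series u m).
    by rewrite -[RHS](dist_translation dP _ _ (series u m)) add0r subrK.
  apply: e'P => /=; rewrite subr0 sub_series_geq//.
  apply: le_lt_trans n0P; apply: le_trans (Fnorm_sum _ _ NF Ntop) _.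
  apply: (@le_trans _ _ (\sum_(m <= i < n) (2^-1 : R) ^+ i)); first exact: ler_sum.
  apply: le_trans (sum_half_lt _ _ _) _; rewrite ler_pM2l//.
  by rewrite ler_wiXn2l// invf_le1// ler1n.
exists n0 => m n n0m n0n; have [mn|/ltnW nm] := leqP m n; first by apply: key; rewrite n0m.
by rewrite (dist_sym dP); apply: key; rewrite n0n.
Qed.

(** [bump i0] skips [i0]: once n >= i0, the first n new terms are the first n + 1 old ones without
    [u i0]. *)
Lemma series_remove (R : realType) (K : numFieldType)
    (X : topologicalLmodType K) (N : X -> R) (u : nat -> X) (l : X) (i0 : nat) :
  induces_topology (fun x y => N (y - x)) ->
  series u @ \oo --> l -> series (u \o bump i0) @ \oo --> l - u i0.
Proof.
move=> Ntop /(Fnorm_cvgP _ _ Ntop) ul; apply/(Fnorm_cvgP _ _ Ntop) => e e0.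
have [n0 n0P] := ul e e0; exists (n0 + i0)%N => n nn.
have i0n : (i0 < n.+1)%N by rewrite ltnS; apply: leq_trans nn; exact: leq_addl.
have -> : series (u \o bump i0) n = series u n.+1 - u i0.
  by rewrite /series /= !big_mkord (bigD1_ord (Ordinal i0n))//= [RHS]addrC addKr.
rewrite opprB addrA subrK; apply: n0P.
by rewrite leqW// (leq_trans _ nn)// leq_addr.
Qed.

(** * Usable forms of the criterion, the group law and separability *)

(** The radius is 4^r - 1 because the criterion will be applied to lattice differences, of size at
    least 4^r, shifted by a vector of size at most 1. *)
Lemma criterion_radius (R : realType) (K : numFieldType)
    (X : topologicalLmodType K) (N : X -> R) (d : nat)
    (T : 'rV[R]_d -> {linear X -> X}) (f : X) :
  ereal_sup [set (N s)%:E | s in [set s : X | exists a, [/\ one_separated a,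
       forall i, C <= enorm (a i) & series (fun i => T (a i) f) @ \oo --> s]]]
    @[C --> +oo] --> 0%E ->
  forall e : R, 0 < e -> exists r : nat, forall a s, one_separated a ->
    (forall i, 4 ^+ r - 1 <= enorm (a i)) ->
    series (fun i => T (a i) f) @ \oo --> s -> N s < e.
Proof.
move=> sup0 e e0.
have /sup0[M [_ MP]] : nbhs (0 : \bar R)%E [set y | (y < e%:E)%E].
  by apply: open_nbhs_nbhs; split; [exact: open_ereal_lt_ereal|rewrite /= lte_fin].
exists (Num.truncn `|M|).+1 => a s asep aC cs.
rewrite -lte_fin; apply: le_lt_trans (MP (4 ^+ (Num.truncn `|M|).+1 - 1) _).
  by apply: ereal_sup_ubound; exists s => //; exists a.
apply: le_lt_trans (ler_norm M) _; rewrite ltrBrDr.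
have /andP[_ Mlt] := truncn_itv (normr_ge0 M).
apply: (@lt_le_trans _ _ ((Num.truncn `|M|).+1%:R + 1)); first by rewrite ltrD2r.
by rewrite natr1 -natrX ler_nat ltn_expl.
Qed.

Lemma iter_opgroup (R : realType) (K : numFieldType) (X : topologicalLmodType K)
    (d : nat) (T : 'rV[R]_d -> {linear X -> X}) a n x :
  operator_group T -> iter n (T a) x = T (a *+ n) x.
Proof.
move=> TG; elim: n => [|n IH]; first by rewrite (opgroup0 TG).
by rewrite iterS IH mulrS (opgroupD TG).
Qed.

(** An injection of the dense set into [nat] is inverted; numbers outside its image get the default
    [x0]. *)
Lemma dense_sequence (X : topologicalType) (x0 : X) :
  separable X -> exists g : nat -> X,
  forall U : set X, open U -> U !=set0 -> exists j, U (g j).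
Proof.
move=> [S /countable_injP[h h_inj] Sdense].
exists (fun n => xget x0 [set x | S x /\ h x = n]) => U Uo U0.
have [x [Ux Sx]] := Sdense U U0 Uo; exists (h x).
have ex : exists y, [set y | S y /\ h y = h x] y by exists x.
have [Sy hy] := @xgetPex _ x0 [set y | S y /\ h y = h x] ex.
by rewrite (h_inj _ _ _ _ hy)// inE.
Qed.

(** * Construction of the vector *)

(** [T c] turns the term of [b] into [T (c - b) (f k)]. The rest of index j is a sum over points of
    norm at least 4^(r m) - 1 with m = max(j, k), so its F-norm is below 4^-m <= 2^-k 2^-j. Summing
    over j gives 2 * 2^-k; the third 2^-k covers truncation. *)
Lemma shell_vector (R : realType) (K : numFieldType) (X : topologicalLmodType K)
    (N : X -> R) (d : nat) (T : 'rV[R]_d -> {linear X -> X})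
    (f : nat -> X) (r : nat -> nat) :
  F_space R X -> is_Fnorm N -> induces_topology (fun x y => N (y - x)) ->
  (1 <= d)%N -> operator_group T ->
  (forall k a, one_separated a ->
     exists s : X, series (fun i => T (a i) (f k)) @ \oo --> s) ->
  (forall k m, (k <= m)%N -> forall a s, one_separated a ->
     (forall i, 4 ^+ r m - 1 <= enorm (a i)) ->
     series (fun i => T (a i) (f k)) @ \oo --> s -> N s < 4^-1 ^+ m) ->
  exists x, forall k b c, shell_lattice R d (r k) k b -> `|c - b| <= 1 ->
    N (T c x - T (c - b) (f k)) < 3 * 2^-1 ^+ k.
Proof.
move=> XF NF Ntop d1 TG conv small.
have /choice[b bP] k := shell_lattice_enum R (r k) k d1.
have bB k i : shell_lattice R d (r k) k (b k i).
  by have [_ <-] := bP k; exists i.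
have b_inj k : injective (b k) by have [] := bP k.
have translate_sep k c (h : nat -> nat) : injective h ->
    one_separated (fun i => c - b k (h i)).
  move=> h_inj i j ij; apply: le_trans (normr_le_enorm _).
  rewrite opprB addrC addrA subrK.
  apply: le_trans (shell_lattice_separated (bB _ _) (bB _ _) _).
    by rewrite exprn_ege1// ler1n.
  by move/b_inj/h_inj => ji; apply: ij.
have /choice[s sP] k := conv k _ (translate_sep k 0 id (@inj_id _)).
have Tcont c (u : nat -> X) (l : X) : u @ \oo --> l -> T c \o u @ \oo --> T c l.
  by move=> ul; apply: continuous_cvg ul; exact: (opgroup_continuous TG).
have Tseries c (u : nat -> X) (l : X) :
    series u @ \oo --> l -> series (T c \o u) @ \oo --> T c l.
  have -> : series (T c \o u) = T c \o series u.
    by apply/funext => n; rewrite /series /= raddf_sum.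
  exact: Tcont.
have Ts c k : series (fun i => T (c - b k i) (f k)) @ \oo --> T c (s k).
  have -> : (fun i => T (c - b k i) (f k)) = T c \o (fun i => T (0 - b k i) (f k)).
    by apply/funext => i /=; rewrite -(opgroupD TG) sub0r.
  exact: Tseries (sP k).
have pow4 m : (4^-1 : R) ^+ m = 2^-1 ^+ m * 2^-1 ^+ m.
  by rewrite -exprMn; congr (_ ^+ _); lra.
have half_le (m n : nat) : (m <= n)%N -> (2^-1 : R) ^+ n <= 2^-1 ^+ m.
  by move=> mn; rewrite ler_wiXn2l// invf_le1// ler1n.
have half_ge0 m : 0 <= (2^-1 : R) ^+ m by rewrite exprn_ge0.
have [x xP] : exists x : X, series s @ \oo --> x.
  apply: (Fnorm_summable XF NF Ntop) => k.
  apply: (@le_trans _ _ (4^-1 ^+ k)).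
    apply/ltW/(small k k (leqnn k) _ _ (translate_sep k 0 id (@inj_id _)) _ (sP k)).
    move=> i; apply: le_trans (normr_le_enorm _); rewrite sub0r normrN.
    by have := shell_lattice_norm (bB k i); lra.
  by rewrite pow4 ler_piMl// -(expr0 2^-1) half_le.
exists x => k b0 c Bb0 cb.
have [i0 b0E] : exists i, b k i = b0.
  by have [_ bE] := bP k; move: Bb0; rewrite -bE => -[i _ <-]; exists i.
rewrite -b0E in cb *.
set y := T (c - b k i0) (f k).
pose w j := T c (s j) - (if j == k then y else 0).
have dist_le z : `|b k i0 - z| - 1 <= enorm (c - z).
  apply: le_trans (normr_le_enorm _).
  have -> : c - z = (c - b k i0) + (b k i0 - z) by rewrite addrA subrK.
  have := lerB_normD (b k i0 - z) (c - b k i0).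
  by rewrite [b k i0 - z + _]addrC; lra.
have wN j : N (w j) <= 2^-1 ^+ k * 2^-1 ^+ j.
  pose m := maxn j k.
  apply: (@le_trans _ _ (4^-1 ^+ m)); last first.
    by rewrite pow4 ler_pM// half_le// ?leq_maxl ?leq_maxr.
  apply/ltW; rewrite /w; have [jk|jk] := eqVneq j k.
    subst j.
    (* [bump i0] lists the points of index [k] other than the hit one. *)
    apply: (small k _ (leq_maxr _ _) (fun i => c - b k (bump i0 i))).
    - exact: translate_sep (can_inj (bumpK i0)).
    - move=> i /=; apply: le_trans (dist_le _); rewrite /m maxnn lerD2r.
      apply: (shell_lattice_separated (bB k i0) (bB k (bump i0 i))).
      by move/b_inj => ii; have := neq_bump i0 i; rewrite -ii eqxx.
    - exact: (series_remove Ntop (Ts c k)).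
  rewrite subr0; apply: (small j m (leq_maxl _ _) _ _
    (translate_sep j c id (@inj_id _)) _ (Ts c j)) => i.
  apply: le_trans (dist_le _); rewrite lerD2r.
  have [F1 F2] := shell_lattice_far (bB k i0) (bB j i) (nesym (elimN eqP jk)).
  by rewrite /m; case: (leqP j k) => _.
have /(Fnorm_cvgP _ _ Ntop)/(_ (2^-1 ^+ k)) := Tseries c _ _ xP.
case=> [|n0 n0P]; first by rewrite exprn_gt0.
(* Beyond [k], so that the partial sum contains the index from which [y] is removed. *)
pose n := (n0 + k.+1)%N.
have kn : (k < n)%N by rewrite /n addnS ltnS leq_addl.
have wE : \sum_(0 <= j < n) w j = series (T c \o s) n - y.
  rewrite sumrB /series; congr (_ - _).
  rewrite big_mkord (bigD1 (Ordinal kn))//= eqxx big1 ?addr0// => j jk.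
  by rewrite ifN.
have -> : T c x - y = - (series (T c \o s) n - T c x) + \sum_(0 <= j < n) w j.
  by rewrite wE opprB addrA subrK.
apply: le_lt_trans (Fnorm_triangle NF _ _) _; rewrite (FnormN _ NF).
have sumN : N (\sum_(0 <= j < n) w j) <= 2 * 2^-1 ^+ k.
  apply: le_trans (Fnorm_sum _ _ NF Ntop) _.
  apply: (@le_trans _ _ (\sum_(0 <= j < n) 2^-1 ^+ k * 2^-1 ^+ j)); first exact: ler_sum.
  rewrite -mulr_sumr mulrC ler_wpM2r//.
  by have := sum_half_lt R 0 n; rewrite expr0 mulr1.
by have := n0P n (leq_addr _ _); lra.
Qed.

(** * Strong continuity and the common frequently hypercyclic vector *)

(** The cap of [delta] by 1 matches the tolerances in [shell_vector] and [shell_lattice_hits]. *)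
Lemma strong_continuity_at0 (R : realType) (K : numFieldType)
    (X : topologicalLmodType K) (N : X -> R) (d : nat)
    (T : 'rV[R]_d -> {linear X -> X}) (f : X) (e : R) :
  induces_topology (fun x y => N (y - x)) -> operator_group T ->
  strongly_continuous T -> 0 < e ->
  exists2 delta : R, 0 < delta <= 1 &
    forall c, `|c| < delta -> N (T c f - f) < e.
Proof.
move=> Ntop TG Tc e0.
have near0 : nbhs (T 0 f) [set y | N (y - T 0 f) < e] by apply/Ntop; exists e.
have /nbhs_ballP[delta /= delta0 deltaP] :
  nbhs (0 : 'rV[R]_d) [set c | N (T c f - T 0 f) < e] := Tc f 0 _ near0.
exists (Num.min delta 1); first by rewrite lt_min delta0 ltr01 ge_min lexx orbT.
move=> c; rewrite lt_min => /andP[cd _].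
have := deltaP c; rewrite /= (opgroup0 TG); apply.
by rewrite -ball_normE /= sub0r normrN.
Qed.

Unset Implicit Arguments.

Theorem theorem5p8 (R : realType) (k : scalar_kind)
    (X : topologicalLmodType (scalars R k)) (N : X -> R)
    (d : nat) (T : 'rV[R]_d -> {linear X -> X})
    (X_F_space : F_space R X) (X_separable : separable X)
    (N_Fnorm : is_Fnorm N) (N_topology : induces_topology (fun x y => N (y - x)))
    (d_ge1 : (1 <= d)%N)
    (T_group : operator_group T) (T_continuous : strongly_continuous T)
    (T_criterion : uniform_FHC_criterion N T) :
  (\bigcap_(a in [set a : 'rV[R]_d | a <> 0]) FHC R (T a)) !=set0.
Proof.
have [D Ddense crit] := T_criterion.
have [g g_dense] := dense_sequence (0 : X) X_separable.
have half_gt0 j : 0 < (2^-1 : R) ^+ j by rewrite exprn_gt0.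
(* The valuation of [j.+1] takes each value infinitely often, so every [g i] is approached by
   infinitely many [f j], with errors tending to 0. *)
have /choice[f fP] j : exists y, D y /\ N (y - g (logn 2 j.+1)) < 2^-1 ^+ j.
  have gnbhs : nbhs (g (logn 2 j.+1))
      [set y | N (y - g (logn 2 j.+1)) < 2^-1 ^+ j].
    by apply/N_topology; exists (2^-1 ^+ j).
  have [|y [yN yD]] := Ddense _ _ (open_interior
    [set y | N (y - g (logn 2 j.+1)) < 2^-1 ^+ j]).
    by exists (g (logn 2 j.+1)); exact: gnbhs.
  by exists y; split=> //; exact: interior_subset yN.
have fD j : D (f j) by have [] := fP j.
have quarter_gt0 j : 0 < (4^-1 : R) ^+ j by rewrite exprn_gt0.
have /choice[rho rhoP] (p : nat * nat) := criterion_radius (crit _ (fD p.1)).2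
  (quarter_gt0 p.2).
(* One radius serving all of f 0, ..., f m at precision 4^-m. *)
pose r m := (\max_(i < m.+1) rho (nat_of_ord i, m))%N.
have [|x xP] := @shell_vector _ _ _ N d T f r X_F_space N_Fnorm N_topology d_ge1
    T_group (fun j => (crit _ (fD j)).1).
  move=> j m jm a s asep aC cs; apply: (rhoP (j, m)) cs => // i.
  apply: le_trans (aC i); rewrite lerD2r ler_eXn2l ?ltr1n// /r.
  rewrite -ltnS in jm.
  exact: (leq_bigmax (F := fun i : 'I_m.+1 => rho (nat_of_ord i, m)) (Ordinal jm)).
exists x => a /= a0 U Uo U0.
have [j Ugj] := g_dense U Uo U0.
have /N_topology[e e0 eU] := open_nbhs_nbhs (conj Uo Ugj).
(* [m.+1] has valuation [j], so [f m] is close to [g j], and m + 1 >= M makes 2^m exceed 5 / e. *)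
pose M := (Num.truncn (5 / e)).+1; pose m := (shell_exponent j M).-1.
have mE : m.+1 = shell_exponent j M.
  by rewrite prednK//; exact: leq_trans (leq_shell_exponent j M).
(* 5 = 3 + 1 + 1: the errors from [shell_vector], from strong continuity and from replacing [g j] by
   [f m]. *)
have me : 5 * (2^-1 : R) ^+ m < e.
  rewrite exprVn ltr_pdivrMr ?exprn_gt0// mulrC -ltr_pdivrMr//.
  have /andP[_ /lt_le_trans] := truncn_itv (divr_ge0 (ler0n R 5) (ltW e0)).
  apply; rewrite -natrX ler_nat -/M; apply: leq_trans (ltn_expl m (ltnSn 1)).
  by rewrite mE leq_shell_exponent.
have [delta delta01 deltaP] :=
  strong_continuity_at0 (f m) N_topology T_group T_continuous (half_gt0 m).
apply: (@shell_lattice_hits R d (r m) m a delta) => // n b Bb nb.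
rewrite /= (iter_opgroup _ _ _ T_group); apply: eU => /=.
have [_ delta1] := andP delta01.
have near1 := xP m b (a *+ n) Bb (le_trans (ltW nb) delta1).
have near2 := deltaP _ nb.
have [_] := fP m; rewrite mE logn_shell_exponent => near3.
set y := T (a *+ n - b) (f m) in near1 near2.
have -> : T (a *+ n) x - g j = (T (a *+ n) x - y) + ((y - f m) + (f m - g j)).
  by rewrite !addrA !subrK.
apply: le_lt_trans me.
apply: le_trans (Fnorm_triangle N_Fnorm _ _) _.
have := Fnorm_triangle N_Fnorm (y - f m) (f m - g j).
lra.
Qed.
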